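(* In the complex Hilbert space $L_2(\mathbb{R})$, the differentiation operator $A:=\dfrac{d}{dx}$ with the domain \[ D(A):=W_2^1(\mathbb{R}):=\left\{f\in L_2(\mathbb{R})\mid f(\cdot)\text{ is absolutely continuous on }\mathbb{R}\text{ with } f'\in L_2(\mathbb{R})\right\} \] is non-hypercyclic, and so is the left-translation strongly continuous unitary operator group generated by $A$, i.e., the group $\{T(t)\}_{t\in\mathbb{R}}$ given by $(T(t)f)(x)=f(x+t)$ for $f\in L_2(\mathbb{R})$, $t,x\in\mathbb{R}$.
   Context: A linear operator $A:X\supseteq D(A)\to X$ (bounded or unbounded) in a Banach space $X$ is hypercyclic if there is a nonzero vector $f\in C^\infty(A):=\bigcap_{n=0}^\infty D(A^n)$ (with $A^0:=I$ the identity operator) whose orbit $\{A^nf\}_{n\in\mathbb{Z}_+}$, $\mathbb{Z}_+=\{0,1,2,\dots\}$, is dense in $X$. A collection $\{T(t)\}_{t\in J}$ ($J$ a nonempty index set) of linear operators in $X$ is hypercyclic if there is a nonzero vector $f\in\bigcap_{t\in J}D(T(t))$ whose orbit $\{T(t)f\}_{t\in J}$ is dense in $X$. Non-hypercyclic means not hypercyclic. As usual for $L_2$-classes, ''$f$ is absolutely continuous on $\mathbb{R}$'' means that $f$ has a representative that is absolutely continuous on every compact interval, and $f'$ is its almost everywhere derivative. *)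

(* Defs.v *)
From HB Require Import structures.
From mathcomp Require Import all_boot all_order all_algebra.
From mathcomp Require Import complex.
From mathcomp Require Import all_classical all_reals all_analysis.
From mathcomp Require Import measurable_realfun.

Set Implicit Arguments.
Unset Strict Implicit.
Unset Printing Implicit Defensive.

Import Order.TTheory GRing.Theory Num.Theory.
Import numFieldNormedType.Exports.

Local Open Scope classical_set_scope.
Local Open Scope ring_scope.
Local Open Scope quotient_scope.

(* A possibly unbounded linear operator from a subspace [dom] of [X] to [X].
   The values of [fn] outside [dom] are irrelevant. *)
Record linop (K : pzRingType) (X : lmodType K) := LinOp {
  dom : set X;
  fn :> X -> X;
  dom0 : dom 0;
  dom_lin : forall (a : K) u v, dom u -> dom v -> dom (a *: u + v);
  fn_lin : forall (a : K) u v, dom u -> dom v ->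
    fn (a *: u + v) = a *: fn u + fn v }.

Section Operators.
Variables (K : pzRingType) (X : lmodType K).
Implicit Types A B : linop X.

Definition linop1 : linop X :=
  @LinOp K X setT id Logic.I (fun _ _ _ _ _ => Logic.I) (fun _ _ _ _ _ => erefl).

Lemma fn0 A : A 0 = 0.
Proof.
have := fn_lin 1 (dom0 A) (dom0 A); rewrite !scale1r addr0 => /esym h.
by apply: (addrI (A 0)); rewrite h addr0.
Qed.

Definition linop_comp B A : linop X.
Proof.
refine (@LinOp K X [set f | dom A f /\ dom B (A f)] (B \o A) _ _ _).
- by split; [exact: dom0|rewrite fn0; exact: dom0].
- move=> a u v [Au Bu] [Av Bv]; split; first exact: dom_lin.
  by rewrite fn_lin//; exact: dom_lin.
- by move=> a u v [Au Bu] [Av Bv] /=; rewrite !fn_lin.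
Defined.

Definition linop_exp A n : linop X := iter n (linop_comp A) linop1.

Definition Cinfty A : set X := \bigcap_n dom (linop_exp A n).

End Operators.

Section Hypercyclicity.
Variables (K : numFieldType) (X : normedModType K).

Definition hypercyclic (A : linop X) : Prop :=
  exists f : X,
    [/\ f != 0, Cinfty A f & dense (range (fun n => linop_exp A n f))].

Definition hypercyclic_family (J : Type) (T : J -> linop X) : Prop :=
  exists f : X,
    [/\ f != 0, forall t, dom (T t) f & dense (range (fun t => T t f))].

End Hypercyclicity.

Section L2pred.
Variable R : realType.
Local Notation C := R[i].
Local Notation mu := (@lebesgue_measure R).
Implicit Types (F G : R -> C^o) (a : C).

Definition absC F : R -> R := fun x => Normc.normc (F x).

(* [R[i]] carries no sigma-algebra in the library; Borel measurability of a
   complex function is that of its real and imaginary parts. *)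
Definition cmeasurable F :=
  measurable_fun setT (fun x => complex.Re (F x)) /\
  measurable_fun setT (fun x => complex.Im (F x)).

Definition L2norm F : \bar R := ('N[mu]_2%:E [EFin \o absC F])%E.

Definition square_integrable F := cmeasurable F /\ (L2norm F < +oo)%E.

Definition L2pred : {pred R -> C^o} := mem [set F | square_integrable F].

Lemma absC_ge0 F x : 0 <= absC F x.
Proof. by rewrite /absC /Normc.normc; case: (F x) => u v; exact: sqrtr_ge0. Qed.

Lemma normc_normC a : `|a| = (Normc.normc a)%:C%C.
Proof. by []. Qed.

Lemma Re_lin a b c : complex.Re (a * b + c) =
  complex.Re a * complex.Re b - complex.Im a * complex.Im b + complex.Re c.
Proof. by case: a; case: b; case: c. Qed.

Lemma Im_lin a b c : complex.Im (a * b + c) =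
  complex.Re a * complex.Im b + complex.Im a * complex.Re b + complex.Im c.
Proof. by case: a; case: b; case: c. Qed.

Lemma cmeasurable_lin a F G :
  cmeasurable F -> cmeasurable G -> cmeasurable (a *: F + G).
Proof.
move=> [mF1 mF2] [mG1 mG2]; split.
- have -> : (fun x => complex.Re ((a *: F + G) x)) =
    ((cst (complex.Re a) \* (fun x => complex.Re (F x)))
      \- (cst (complex.Im a) \* (fun x => complex.Im (F x))))
      \+ (fun x => complex.Re (G x)).
    by apply/funext => x /=; rewrite -Re_lin.
  by apply: measurable_funD => //; apply: measurable_funB;
     apply: measurable_funM.
- have -> : (fun x => complex.Im ((a *: F + G) x)) =
    ((cst (complex.Re a) \* (fun x => complex.Im (F x)))
      \+ (cst (complex.Im a) \* (fun x => complex.Re (F x))))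
      \+ (fun x => complex.Im (G x)).
    by apply/funext => x /=; rewrite -Im_lin.
  by apply: measurable_funD => //; apply: measurable_funD;
     apply: measurable_funM.
Qed.

Lemma measurable_absC F : cmeasurable F -> measurable_fun setT (absC F).
Proof.
move=> [mF1 mF2].
have -> : absC F =
    (@Num.sqrt R) \o (fun x => complex.Re (F x) ^+ 2 + complex.Im (F x) ^+ 2).
  by apply/funext => x; rewrite /absC /=; case: (F x).
apply: measurableT_comp.
  by apply: continuous_measurable_fun; exact: sqrt_continuous.
by apply: measurable_funD; exact: measurable_funX.
Qed.

Lemma absC_Lfun F : square_integrable F -> absC F \in Lfun mu 2%:E.
Proof.
move=> [mF fF]; apply/andP; split; rewrite inE//=.
exact: measurable_absC.
Qed.

Lemma absCZ a F : absC (a *: F) = Normc.normc a \*: absC F.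
Proof. by apply/funext => x /=; rewrite /absC Normc.normcM. Qed.

Lemma absCD F G x : absC (F + G) x <= absC F x + absC G x.
Proof. exact: (@Num.Theory.ler_normD R (Rcomplex R)). Qed.

Lemma L2normZ a F : square_integrable F ->
  L2norm (a *: F) = ((Normc.normc a)%:E * L2norm F)%E.
Proof.
move=> /absC_Lfun F2; rewrite /L2norm absCZ.
have := LnormZ (Lfun_Sub (lee1n 2) F2) (Normc.normc a).
rewrite /= => ->; congr (_%:E * _)%E.
rewrite ger0_norm//; case: a => u v; exact: sqrtr_ge0.
Qed.

Lemma le_Lnorm2 (f g : R -> R) : measurable_fun setT f -> measurable_fun setT g ->
  (forall x, 0 <= f x) -> (forall x, f x <= g x) ->
  ('N[mu]_2%:E [EFin \o f] <= 'N[mu]_2%:E [EFin \o g])%E.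
Proof.
move=> mf mg f0 fg; rewrite unlock /Lnorm.
have int0 (h : R -> R) :
    (\int[mu]_x (`|(EFin \o h) x| `^ 2))%E \in `[0%E, +oo%E].
  by rewrite in_itv/= leey andbT; apply: integral_ge0 => x _; rewrite lee_fin powR_ge0.
apply: gt0_ler_poweR; rewrite ?invr_ge0//.
have m2 (h : R -> R) : measurable_fun setT h ->
    measurable_fun setT (fun x => (`|(EFin \o h) x| `^ 2)%E).
  move=> mh; under eq_fun do rewrite /= -/(`|h _|%:E `^ 2)%E.
  apply/measurable_EFinP; apply: (measurableT_comp (measurable_powR 2)).
  exact: measurableT_comp.
apply: ge0_le_integral => //=; [exact: m2|exact: m2|].
move=> x _; rewrite lee_fin; apply: ge0_ler_powR; rewrite ?nnegrE//.
by rewrite !ger0_norm// (le_trans (f0 x)).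
Qed.

Lemma L2normD F G : cmeasurable F -> cmeasurable G ->
  (L2norm (F + G)%R <= L2norm F + L2norm G)%E.
Proof.
move=> mF mG; apply: (@le_trans _ _ ('N[mu]_2%:E [EFin \o (absC F \+ absC G)%R])%E).
  apply: le_Lnorm2; [| |exact: absC_ge0|exact: absCD].
  - by apply: measurable_absC; rewrite -[F]scale1r; exact: cmeasurable_lin.
  - by apply: measurable_funD; exact: measurable_absC.
by apply: eminkowski => //; [exact: measurable_absC|exact: measurable_absC|rewrite lee1n].
Qed.

Lemma square_integrable0 : square_integrable 0.
Proof.
split; first by split; exact: measurable_cst.
rewrite /L2norm (_ : _ \o _ = cst 0%E) ?Lnorm0//.
by apply/funext => x /=; rewrite /absC Normc.normc0.
Qed.

Lemma L2pred_submod_closed : submod_closed L2pred.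
Proof.
split=> [|a F G]; first by rewrite inE; exact: square_integrable0.
rewrite !inE => /= F2 G2; split; first exact: cmeasurable_lin F2.1 G2.1.
have mZ : cmeasurable (a *: F).
  rewrite -[_ *: _]addr0; exact: cmeasurable_lin F2.1 square_integrable0.1.
apply: (le_lt_trans (L2normD mZ G2.1)).
rewrite lte_add_pinfty ?G2.2// L2normZ// lte_mul_pinfty ?lee_fin ?F2.2//.
by case: {+}a => u v; exact: sqrtr_ge0.
Qed.

HB.instance Definition _ :=
  GRing.isSubmodClosed.Build C (R -> C^o) L2pred L2pred_submod_closed.

End L2pred.

Record L2fun (R : realType) := MkL2fun {
  L2fun_val :> R -> R[i]^o;
  L2fun_subproof : L2fun_val \in @L2pred R }.

Section L2fun.
Variable R : realType.
Local Notation C := R[i].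
Local Notation mu := (@lebesgue_measure R).

HB.instance Definition _ := [isSub for @L2fun_val R].
HB.instance Definition _ := [Choice of L2fun R by <:].
HB.instance Definition _ := [SubChoice_isSubLmodule of L2fun R by <:].

Lemma L2funP (F : L2fun R) : square_integrable F.
Proof. exact: set_mem (L2fun_subproof F). Qed.

Lemma L2funB (F G : L2fun R) x : (F - G) x = F x - G x.
Proof. by []. Qed.

Definition L2null : {pred L2fun R} :=
  mem [set F : L2fun R | {ae mu, forall x, F x = 0}].

Lemma L2null_zmod_closed : zmod_closed L2null.
Proof.
split=> [|F G]; first by rewrite inE; exact/aeW.
rewrite !inE => /= F0 G0; apply: (@filterS2 _ _ (ae_filter_ringOfSetsType mu)) F0 G0 => x.
move=> Fx Gx; exact: (etrans (congr2 (fun u v : C^o => u - v) Fx Gx) (subrr _)).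
Qed.

HB.instance Definition _ :=
  GRing.isZmodClosed.Build (L2fun R) L2null L2null_zmod_closed.

(* square integrable functions modulo equality almost everywhere, see [L2eqP] *)
Definition L2 : Type := Quotient.quot L2null.
HB.instance Definition _ := Choice.on L2.
HB.instance Definition _ := EqQuotient.on L2.
HB.instance Definition _ := GRing.Zmodule.on L2.

Lemma L2eqP (F G : L2fun R) :
  reflect {ae mu, forall x, F x = G x} (\pi_L2 F == \pi_L2 G).
Proof.
rewrite [_ == _](_ : _ = (F - G \in L2null)); last by rewrite piE.
apply: (iffP idP); rewrite inE /= => h;
  apply: (@filterS _ _ (ae_filter_ringOfSetsType mu)) h => x /=.
- by move=> h; exact: (@subr0_eq C^o (F x) (G x) h).
- move=> h; exact: (etrans (congr1 (fun u : C^o => u - G x) h) (subrr _)).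
Qed.

Lemma L2piD (F G : L2fun R) : \pi_L2 (F + G) = \pi_L2 F + \pi_L2 G.
Proof. exact: Quotient.pi_add. Qed.

Definition L2scale (a : C) := lift_op1 L2 (fun F : L2fun R => a *: F).

Lemma L2piZ a (F : L2fun R) : \pi_L2 (a *: F) = L2scale a (\pi_L2 F).
Proof.
unlock L2scale; apply/eqP/L2eqP.
have /eqP/L2eqP := reprK (\pi_L2 F).
apply: (@filterS _ _ (ae_filter_ringOfSetsType mu)) => x /= Fx.
by rewrite -[LHS]/(a *: F x) -Fx.
Qed.

Lemma L2scaleA a b (f : L2) : L2scale a (L2scale b f) = L2scale (a * b) f.
Proof. by rewrite -[f]reprK -!L2piZ scalerA. Qed.

Lemma L2scale1 : left_id 1 L2scale.
Proof. by move=> f; rewrite -[f]reprK -L2piZ scale1r. Qed.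

Lemma L2scaleDr : right_distributive L2scale +%R.
Proof.
by move=> a f g; rewrite -[f]reprK -[g]reprK -L2piD -!L2piZ scalerDr L2piD.
Qed.

Lemma L2scaleDl (f : L2) : {morph L2scale^~ f : a b / a + b}.
Proof. by move=> a b; rewrite -[f]reprK -!L2piZ scalerDl L2piD. Qed.

HB.instance Definition _ :=
  GRing.Zmodule_isLmodule.Build C L2 L2scaleA L2scale1 L2scaleDr L2scaleDl.

Lemma L2pi_lin a (F G : L2fun R) :
  \pi_L2 (a *: F + G) = a *: \pi_L2 F + \pi_L2 G.
Proof. by rewrite L2piD L2piZ. Qed.

Lemma L2norm_ae (F G : L2fun R) :
  {ae mu, forall x, F x = G x} -> L2norm F = L2norm G.
Proof.
move=> FG; rewrite /L2norm unlock /Lnorm; congr (_ `^ _)%E.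
have m2 (H : L2fun R) : measurable_fun setT 
      (fun x => (`|(EFin \o absC H) x| `^ 2)%E).
  under eq_fun do rewrite /= -/(`|absC H _|%:E `^ 2)%E.
  apply/measurable_EFinP; apply: (measurableT_comp (measurable_powR 2)).
  by apply: measurableT_comp => //; exact: measurable_absC (L2funP H).1.
apply: ae_eq_integral => //; [exact: m2|exact: m2|].
apply: (@filterS _ _ (ae_filter_ringOfSetsType mu)) FG => x /= Fx _.
by rewrite /absC Fx.
Qed.

Lemma L2norm_fin (F : L2fun R) : L2norm F \is a fin_num.
Proof. by rewrite ge0_fin_numE ?Lnorm_ge0//; exact: (L2funP F).2. Qed.

(* A [normedModType K] has its norm in [K], whence the [%:C]. *)
Definition L2nrm (f : L2) : C := (fine (L2norm (repr f)))%:C%C.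

Lemma L2nrmE (F : L2fun R) : L2nrm (\pi_L2 F) = (fine (L2norm F))%:C%C.
Proof. by congr (fine _)%:C%C; apply: L2norm_ae; apply/L2eqP; rewrite reprK. Qed.

Lemma L2nrmD (f g : L2) : L2nrm (f + g) <= L2nrm f + L2nrm g.
Proof.
rewrite -[f]reprK -[g]reprK -L2piD !L2nrmE -rmorphD lecR.
rewrite -lee_fin EFinD !fineK ?L2norm_fin//.
apply: L2normD; [exact: (L2funP _).1|exact: (L2funP _).1].
Qed.

Lemma L2nrmZ a (f : L2) : L2nrm (a *: f) = `|a| * L2nrm f.
Proof.
rewrite -[f]reprK -[_ *: _]L2piZ !L2nrmE normc_normC -rmorphM; congr _%:C%C.
rewrite (_ : L2norm _ = L2norm (a *: (repr f : R -> C^o)))//.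
by rewrite L2normZ ?fineM ?L2norm_fin//; exact: L2funP.
Qed.

Lemma L2nrm0 (f : L2) : L2nrm f = 0 -> f = 0.
Proof.
rewrite -[f]reprK L2nrmE => /complexI /eqP; rewrite fine_eq0 ?L2norm_fin// => /eqP.
move/Lnorm_eq0_eq0 => F0; have /F0 {}F0 : measurable_fun setT (EFin \o absC (repr f)).
  by apply/measurable_EFinP; exact: measurable_absC (L2funP _).1.
have -> : 0 = \pi_L2 (0 : L2fun R) :> L2 by rewrite piE.
apply/eqP/L2eqP; have := F0 (ltr0n _ 2).
apply: (@filterS _ _ (ae_filter_ringOfSetsType mu)) => x /(_ Logic.I) [].
exact: Normc.eq0_normc.
Qed.

HB.instance Definition _ := Lmodule_isNormed.Build C L2 L2nrmD L2nrmZ L2nrm0.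

End L2fun.

Section translation.
Variable R : realType.
Local Notation C := R[i].
Local Notation mu := (@lebesgue_measure R).

Definition shiftf (t : R) (F : R -> C^o) : R -> C^o := fun x => F (x + t).

Let tr (t : R) : measurableTypeR R -> measurableTypeR R := fun x => x + t.

Let measurable_tr t : measurable_fun setT (tr t).
Proof. by apply: measurable_funD => //; exact: measurable_cst. Qed.

HB.instance Definition _ t :=
  isMeasurableFun.Build _ _ _ _ (tr t) (measurable_tr t).

Let lebesgue_measure_tr t (A : set (measurableTypeR R)) :
  measurable A -> pushforward mu (tr t) A = mu A.
Proof.
move=> mA; apply/esym/lebesgue_measure_unique => //= _ [[a b]] _ <-.
rewrite /pushforward.
have -> : tr t @^-1` `]a, b] = `]a - t, b - t]%classic.
  by apply/seteqP; split => x /=; rewrite /tr !in_itv/= ltrBlDr lerBrDr.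
by rewrite !lebesgue_measure_itv/= !lte_fin ltrD2r; case: ifP => // _;
   rewrite -!EFinB opprB addrA subrK.
Qed.

Lemma L2norm_shift t F : cmeasurable F -> L2norm (shiftf t F) = L2norm F.
Proof.
move=> mF; rewrite /L2norm unlock /Lnorm; congr (_ `^ _)%E.
have m2 : measurable_fun setT (fun x => (`|(EFin \o absC F) x| `^ 2)%E).
  under eq_fun do rewrite /= -/(`|absC F _|%:E `^ 2)%E.
  apply/measurable_EFinP; apply: (measurableT_comp (measurable_powR 2)).
  by apply: measurableT_comp => //; exact: measurable_absC.
rewrite -[LHS]/(\int[mu]_(x in tr t @^-1` setT)
  ((fun x => (`|(EFin \o absC F) x| `^ 2)%E) \o tr t) x)%E.
rewrite -ge0_integral_pushforward//=.
by apply: eq_measure_integral => A mA _; exact: lebesgue_measure_tr.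
Qed.

Lemma cmeasurable_shift t F : cmeasurable F -> cmeasurable (shiftf t F).
Proof.
move=> [mF1 mF2]; split.
- exact: (measurableT_comp mF1 (measurable_tr t)).
- exact: (measurableT_comp mF2 (measurable_tr t)).
Qed.

Lemma ae_shift t (P : R -> Prop) :
  {ae mu, forall x, P x} -> {ae mu, forall x, P (x + t)}.
Proof.
move=> [A [mA A0 PA]]; exists (tr t @^-1` A); split.
- by rewrite -[X in measurable X]setTI; exact: measurable_tr.
- by rewrite -A0; exact: lebesgue_measure_tr.
- by move=> x /= Px; exact: PA.
Qed.

Lemma L2pred_shift t (F : L2fun R) : shiftf t F \in @L2pred R.
Proof.
have [mF fF] := L2funP F; rewrite inE; split; first exact: cmeasurable_shift.
by rewrite L2norm_shift.
Qed.

Definition L2fun_shift t (F : L2fun R) : L2fun R := MkL2fun (L2pred_shift t F).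

Definition translation_fun (t : R) : L2 R -> L2 R :=
  lift_op1 (L2 R) (L2fun_shift t).

Lemma translationE t (F : L2fun R) :
  translation_fun t (\pi_(L2 R) F) = \pi_(L2 R) (L2fun_shift t F).
Proof.
rewrite /translation_fun; unlock; apply/eqP/L2eqP.
have /eqP/L2eqP := reprK (\pi_(L2 R) F).
exact: (@ae_shift t (fun x => repr (\pi_(L2 R) F) x = F x)).
Qed.

Lemma translation_lin t (a : C) (f g : L2 R) :
  translation_fun t (a *: f + g) = a *: translation_fun t f + translation_fun t g.
Proof.
rewrite -[f]reprK -[g]reprK -L2pi_lin !translationE -L2pi_lin.
by congr (\pi_(L2 R) _); apply: val_inj.
Qed.

Definition translation (t : R) : linop (L2 R) :=
  @LinOp C (L2 R) setT (translation_fun t) Logic.I (fun _ _ _ _ _ => Logic.I)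
    (fun a f g _ _ => translation_lin t a f g).

Lemma translation_norm t (f : L2 R) : `|translation t f| = `|f|.
Proof.
rewrite -[f]reprK /= translationE.
rewrite -[LHS]/(L2nrm _) -[RHS]/(L2nrm _) !L2nrmE.
by rewrite L2norm_shift//; exact: (L2funP _).1.
Qed.

Lemma translation0 (f : L2 R) : translation 0 f = f.
Proof.
rewrite -[f]reprK /= translationE; congr (\pi_(L2 R) _); apply: val_inj.
by apply/funext => x; rewrite /= /shiftf addr0.
Qed.

Lemma translationD s t (f : L2 R) :
  translation (s + t) f = translation s (translation t f).
Proof.
rewrite -[f]reprK /= !translationE; congr (\pi_(L2 R) _); apply: val_inj.
by apply/funext => x; rewrite /= /shiftf addrA.
Qed.

End translation.

Section differentiation.
Variable R : realType.
Local Notation C := R[i].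
Local Notation mu := (@lebesgue_measure R).
Local Notation normc := Normc.normc.

Definition abs_continuous_on (a b : R) (F : R -> C^o) : Prop :=
  forall e : R, 0 < e -> exists2 d : R, 0 < d &
    forall (n : nat) (s t : 'I_n -> R),
      (forall i, [/\ a <= s i, s i <= t i & t i <= b]) ->
      trivIset setT (fun i => `]s i, t i[%classic) ->
      \sum_(i < n) (t i - s i) < d ->
      \sum_(i < n) normc (F (t i) - F (s i)) < e.

Definition abs_continuous (F : R -> C^o) : Prop :=
  forall a b : R, abs_continuous_on a b F.

Definition is_cderive (F : R -> C^o) (x : R) (z : C) : Prop :=
  is_derive x 1 (fun y => complex.Re (F y)) (complex.Re z) /\
  is_derive x 1 (fun y => complex.Im (F y)) (complex.Im z).

Definition ae_derivative (F G : R -> C^o) : Prop :=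
  {ae mu, forall x, is_cderive F x (G x)}.

(* [f] has an absolutely continuous representative [F], and the almost
   everywhere derivative of [F] is square integrable with class [g].  Absolutely
   continuous functions are differentiable almost everywhere, so the existence
   of the derivative in [ae_derivative] is no restriction on [F]. *)
Definition ddx_graph (f g : L2 R) : Prop := exists F G : L2fun R,
  [/\ f = \pi_(L2 R) F, g = \pi_(L2 R) G, abs_continuous F & ae_derivative F G].

Definition W21 : set (L2 R) := [set f | exists g, ddx_graph f g].

(* single-valued on [W21], see [ddx_graph_unique] and [ddx_funP] *)
Definition ddx_fun (f : L2 R) : L2 R := xget 0 [set g | ddx_graph f g].

Lemma abs_continuous_lin (a : C) (F G : L2fun R) :
  abs_continuous F -> abs_continuous G -> abs_continuous (a *: F + G).
Proof.
move=> acF acG u v e e0.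
have na0 : 0 <= normc a by case: (a) => ? ?; exact: sqrtr_ge0.
have [|d1 d10 dF] := acF u v (e / 2 / (normc a + 1)).
  by rewrite !divr_gt0// ltr_wpDl.
have [|d2 d20 dG] := acG u v (e / 2); first by rewrite divr_gt0.
exists (Num.min d1 d2); first by rewrite lt_min d10.
move=> n s t stuv tst; rewrite lt_min => /andP[sd1 sd2].
have {dF sd1} F1 := dF n s t stuv tst sd1.
have {dG sd2} G1 := dG n s t stuv tst sd2.
rewrite [ltRHS](splitr e).
apply: (@le_lt_trans _ _ (normc a * \sum_(i < n) normc (F (t i) - F (s i)) +
   \sum_(i < n) normc (G (t i) - G (s i)))).
  rewrite mulr_sumr -big_split/=; apply: ler_sum => i _.
  rewrite -Normc.normcM; apply: le_trans (@Num.Theory.ler_normD R (Rcomplex R) _ _).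
  rewrite [leRHS](_ : _ = normc ((a * F (t i) + G (t i)) - (a * F (s i) + G (s i)))) //.
  by congr normc; rewrite mulrBr opprD addrACA.
apply: ler_ltD => //.
apply: (@le_trans _ _ (normc a * (e / 2 / (normc a + 1)))).
  by apply: ler_wpM2l => //; exact: ltW.
rewrite mulrCA ler_piMr ?divr_ge0 ?ltW//.
by rewrite ltr_pdivrMr ?mul1r ?ltrDl// ltr_wpDl.
Qed.

Lemma ae_derivative_lin (a : C) (F G F' G' : L2fun R) :
  ae_derivative F F' -> ae_derivative G G' ->
  ae_derivative (a *: F + G) (a *: F' + G').
Proof.
apply: (@filterS2 _ _ (ae_filter_ringOfSetsType mu)) => x /= [dF1 dF2] [dG1 dG2].
split.
- have -> : (fun y => complex.Re ((a *: F + G : L2fun R) y)) =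
    (complex.Re a \*: (fun y => complex.Re (F y))
      - complex.Im a \*: (fun y => complex.Im (F y)))
      + (fun y => complex.Re (G y)).
    by apply/funext => y; exact: Re_lin.
  rewrite [X in is_derive _ _ _ X](_ : _ = (complex.Re a *: complex.Re (F' x) -
    complex.Im a *: complex.Im (F' x)) + complex.Re (G' x)) ; last exact: Re_lin.
  exact: is_deriveD.
- have -> : (fun y => complex.Im ((a *: F + G : L2fun R) y)) =
    (complex.Re a \*: (fun y => complex.Im (F y))
      + complex.Im a \*: (fun y => complex.Re (F y)))
      + (fun y => complex.Im (G y)).
    by apply/funext => y; exact: Im_lin.
  rewrite [X in is_derive _ _ _ X](_ : _ = (complex.Re a *: complex.Im (F' x) +
    complex.Im a *: complex.Re (F' x)) + complex.Im (G' x)) ; last exact: Im_lin.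
  exact: is_deriveD.
Qed.

Lemma abs_continuous_eq (F G : R -> C^o) : abs_continuous F -> abs_continuous G ->
  {ae mu, forall x, F x = G x} -> F = G.
Proof.
move=> acF acG [N [mN N0 FG]]; apply/funext => x; apply/eqP; apply: contrapT => FGx.
have e0 : 0 < normc (F x - G x) / 2.
  rewrite divr_gt0// lt_neqAle eq_sym; apply/andP; split; last first.
    by case: (F x - G x) => ? ?; exact: sqrtr_ge0.
  by apply/eqP => /Normc.eq0_normc/eqP; rewrite subr_eq0 => /FGx.
have [d1 d10 dF] := acF x (x + 1) _ e0.
have [d2 d20 dG] := acG x (x + 1) _ e0.
pose d := Num.min 1 (Num.min d1 d2).
have d0 : 0 < d by rewrite !lt_min ltr01 d10.
have small (H : R -> C^o) (d' : R) y : d <= d' -> x < y < x + d ->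
   (forall (n : nat) (s t : 'I_n -> R),
      (forall i, [/\ x <= s i, s i <= t i & t i <= x + 1]) ->
      trivIset setT (fun i => `]s i, t i[%classic) ->
      \sum_(i < n) (t i - s i) < d' ->
      \sum_(i < n) normc (H (t i) - H (s i)) < normc (F x - G x) / 2) ->
   normc (H y - H x) < normc (F x - G x) / 2.
  move=> dd' /andP[xy yd] /(_ 1%N (fun=> x) (fun=> y)); rewrite !big_ord1; apply.
  - move=> _; split; rewrite ?(ltW xy)// (le_trans (ltW yd))// lerD2l.
    by rewrite ge_min lexx.
  - by move=> i j _ _ _; rewrite !ord1.
  - by rewrite ltrBlDl (lt_le_trans yd)// lerD2l.
have sub : `]x, x + d[ `<=` N.
  move=> y /=; rewrite in_itv/= => xyd; apply: FG => /= FGy.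
  have F1 := small F d1 y _ xyd dF; have G1 := small G d2 y _ xyd dG.
  have {}F1 : normc (F y - F x) < normc (F x - G x) / 2.
    by apply: F1; rewrite !ge_min lexx orbT.
  have {}G1 : normc (G y - G x) < normc (F x - G x) / 2.
    by apply: G1; rewrite !ge_min lexx !orbT.
  have := ltrD F1 G1; rewrite -splitr ltNge => /negP; apply.
  rewrite -(normcN (F y - F x)).
  apply: le_trans (@Num.Theory.ler_normD R (Rcomplex R) _ _).
  rewrite [leRHS](_ : _ = normc (- (F y - F x) + (G y - G x)))//.
  by rewrite FGy opprB addrA subrK.
have : (mu `]x, (x + d)%R[ <= 0)%E.
  by rewrite -N0; apply: le_measure; rewrite ?inE.
by rewrite lebesgue_measure_itv/= lte_fin ltrDl d0 -EFinD addrAC subrr add0r lee_fin leNgt d0.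
Qed.

Lemma ddx_graph_unique f g h : ddx_graph f g -> ddx_graph f h -> g = h.
Proof.
move=> [F [G [-> -> acF dF]]] [F2 [H [/eqP/L2eqP FF2 -> acF2 dF2]]].
have {}FF2 := abs_continuous_eq acF acF2 FF2.
apply/eqP/L2eqP; move: dF dF2; rewrite -FF2.
apply: (@filterS2 _ _ (ae_filter_ringOfSetsType mu)) => x /= [d1 d2] [d3 d4].
have e1 : complex.Re (G x) = complex.Re (H x) by rewrite -(@derive_val _ _ _ _ _ _ _ d1) -(@derive_val _ _ _ _ _ _ _ d3).
have e2 : complex.Im (G x) = complex.Im (H x) by rewrite -(@derive_val _ _ _ _ _ _ _ d2) -(@derive_val _ _ _ _ _ _ _ d4).
by move: e1 e2; case: (G x) => ? ?; case: (H x) => ? ? /= -> ->.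
Qed.

Lemma ddx_funP f : W21 f -> ddx_graph f (ddx_fun f).
Proof. by move=> [g fg]; exact: (xgetPex 0 (ex_intro _ g fg)). Qed.

Lemma ddx_funE f g : ddx_graph f g -> ddx_fun f = g.
Proof.
by move=> fg; apply: (ddx_graph_unique _ fg); apply: ddx_funP; exists g.
Qed.

Lemma ddx_graph_lin (a : C) f1 g1 f2 g2 : ddx_graph f1 g1 -> ddx_graph f2 g2 ->
  ddx_graph (a *: f1 + f2) (a *: g1 + g2).
Proof.
move=> [F1 [G1 [-> -> acF1 dF1]]] [F2 [G2 [-> -> acF2 dF2]]].
exists (a *: F1 + F2), (a *: G1 + G2); rewrite !L2pi_lin; split => //.
- exact: abs_continuous_lin.
- exact: ae_derivative_lin.
Qed.

Lemma ddx_graph0 : ddx_graph 0 0.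
Proof.
exists 0, 0; rewrite piE; split=> //.
- move=> a b e e0; exists 1 => // n s t _ _ _.
  rewrite big1// => i _.
  by rewrite [X in normc X](_ : _ = 0) ?Normc.normc0//; exact: subrr.
- by apply/aeW => x; split; exact: is_derive_cst.
Qed.

Lemma W21_lin (a : C) f g : W21 f -> W21 g -> W21 (a *: f + g).
Proof.
by move=> /ddx_funP df /ddx_funP dg; eexists; exact: ddx_graph_lin df dg.
Qed.

Lemma ddx_fun_lin (a : C) f g : W21 f -> W21 g ->
  ddx_fun (a *: f + g) = a *: ddx_fun f + ddx_fun g.
Proof.
by move=> /ddx_funP df /ddx_funP dg; apply: ddx_funE; exact: ddx_graph_lin.
Qed.

Definition ddx : linop (L2 R) :=
  @LinOp C (L2 R) W21 ddx_fun (ex_intro _ 0 ddx_graph0) W21_lin ddx_fun_lin.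

End differentiation.

(* Main.v *)
Require Import Defs.
From mathcomp Require Import all_boot all_order all_algebra complex.
From mathcomp Require Import all_classical all_reals all_analysis.
From mathcomp Require Import measurable_realfun.
From mathcomp Require Import ring lra.

(* Translations are isometries, so an orbit of the group stays on a sphere.  As
   d/dx is skew-symmetric, |A^(n+1) f|^2 = - Re <A^n f, A^(n+2) f>
   <= |A^n f| |A^(n+2) f|: the norms along an orbit form a log-convex sequence,
   which is bounded above or bounded away from 0, so the orbit misses an open
   ball.  Skew-symmetry amounts to the vanishing of the integral over R of h'
   when h is locally absolutely continuous and h, h' are integrable.  This uses
   the fundamental theorem of calculus for h, which follows from Lebesgue
   differentiation once a locally absolutely continuous function with almost
   everywhere zero derivative is known to be constant. *)

Set Implicit Arguments.
Unset Strict Implicit.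
Unset Printing Implicit Defensive.

Import Order.TTheory GRing.Theory Num.Theory.
Import numFieldNormedType.Exports.

Local Open Scope classical_set_scope.
Local Open Scope ring_scope.
Local Open Scope quotient_scope.

(** * Ordered chains of intervals *)

Section chains.
Variable R : realType.
Local Notation mu := (@lebesgue_measure R).
Implicit Types (a b x : R) (s t : nat -> R) (n : nat).

(** Only indices below [n] matter. Indexing by [nat] and ordering the intervals, instead of just
    making them disjoint, lets a new interval be appended on the right. *)
Definition interval_chain a b n s t :=
  (forall i, (i < n)%N -> [/\ a <= s i, s i <= t i & t i <= b]) /\
  (forall i j, (i < j < n)%N -> t i <= s j).

Lemma interval_chain_trivIset a b n s t : interval_chain a b n s t ->
  trivIset setT (fun i : 'I_n => `]s i, t i]%classic).
Proof.
move=> [_ st] i j _ _ [x []]; rewrite /= !in_itv/= => /andP[six xti] /andP[sjx xtj].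
apply/val_inj; case: (ltngtP i j) => // ij.
- have := st i j; rewrite ij ltn_ord => /(_ isT) ts.
  by have := le_lt_trans (le_trans xti ts) sjx; rewrite ltxx.
- have := st j i; rewrite ij ltn_ord => /(_ isT) ts.
  by have := le_lt_trans (le_trans xtj ts) six; rewrite ltxx.
Qed.

Lemma interval_chain_measure a b n s t : interval_chain a b n s t ->
  mu (\big[setU/set0]_(i < n) `]s i, t i]%classic) = (\sum_(i < n) (t i - s i))%:E.
Proof.
move=> st; rewrite measure_bigsetU_ord//; last exact: interval_chain_trivIset st.
rewrite -sumEFin; apply: eq_bigr => i _.
rewrite [LHS]lebesgue_measure_itv/= lte_fin; case: ltgtP => // [|->]; last by rewrite subrr.
by have [_ st_i _] := st.1 i (ltn_ord i); rewrite ltNge st_i.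
Qed.

Lemma interval_chain_rcons a b c n s t : interval_chain a b n s t ->
  a <= b -> b <= c ->
  interval_chain a c n.+1 (fun i => if (i < n)%N then s i else b)
    (fun i => if (i < n)%N then t i else c).
Proof.
move=> [st1 st2] ab bc; split=> [i _|i j /andP[ij]].
  by case: ifP => [/st1[? ? ?]|_]; split => //; lra.
rewrite ltnS leq_eqVlt => /predU1P[jn|jn].
  by rewrite -jn ij ltnn; have [] := st1 i; rewrite -?jn.
by rewrite (ltn_trans ij jn) jn; apply: st2; rewrite ij.
Qed.

End chains.

(** * Real-valued locally absolutely continuous functions *)

Section locally_ac.
Variable R : realType.
Local Notation mu := (@lebesgue_measure R).
Implicit Types (a b x : R) (f g : R -> R).

(* Testing absolute continuity on increasing chains of intervals instead of
   arbitrary finite disjoint families makes no difference, up to reordering. *)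
Definition locally_ac f := forall a b e, 0 < e -> exists2 d, 0 < d &
  forall n (s t : nat -> R), interval_chain a b n s t ->
    \sum_(i < n) (t i - s i) < d -> \sum_(i < n) `|f (t i) - f (s i)| < e.

Lemma locally_ac_dist f a b e : locally_ac f -> 0 < e ->
  exists2 d, 0 < d & forall x y, a <= x -> x <= y -> y <= b -> y - x < d ->
    `|f y - f x| < e.
Proof.
move=> acf e0; have [d d0 fd] := acf a b e e0; exists d => // x y ax xy yb yx.
have := fd 1%N (fun=> x) (fun=> y); rewrite !big_ord1; apply => //.
by split=> // i j /andP[ij]; rewrite ltnS leqn0 => /eqP j0; move: ij; rewrite j0.
Qed.

Lemma locally_ac_continuous f : locally_ac f -> continuous f.
Proof.
move=> acf x; apply/cvgrPdist_lt => e e0.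
have [d d0 fd] := locally_ac_dist (x - 1) (x + 1) acf e0.
exists (Num.min d 1); first by rewrite /= lt_min d0 ltr01.
move=> y /=; rewrite lt_min => /andP[]; rewrite !ltr_distlC => /andP[? ?] /andP[? ?].
rewrite -ltr_distlC; have [xy|/ltW yx] := leP x y; first by rewrite distrC; apply: fd; lra.
by apply: fd; lra.
Qed.

Lemma continuous_itv_bounded f a b : continuous f ->
  exists2 M, 0 < M & forall x, a <= x -> x <= b -> `|f x| <= M.
Proof.
move=> cf; have : bounded_set (f @` `[a, b]).
  apply: compact_bounded; apply: continuous_compact; last exact: segment_compact.
  exact: continuous_subspaceT.
move=> [M [_ fM]]; exists (`|M| + 1) => [|x ax xb].
  by rewrite ltr_wpDl.
apply: (fM (`|M| + 1)); first by rewrite (le_lt_trans (ler_norm _))// ltrDl.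
by exists x => //=; rewrite in_itv/= ax.
Qed.

Lemma locally_acD f g : locally_ac f -> locally_ac g -> locally_ac (f \+ g).
Proof.
move=> acf acg a b e e0; have e20 : 0 < e / 2 by rewrite divr_gt0.
have [d1 d10 fd] := acf a b _ e20; have [d2 d20 gd] := acg a b _ e20.
exists (Num.min d1 d2); first by rewrite lt_min d10.
move=> n s t st; rewrite lt_min => /andP[/(fd _ _ _ st) fst /(gd _ _ _ st) gst].
rewrite [ltRHS]splitr; apply: le_lt_trans (ltrD fst gst).
rewrite -big_split/=; apply: ler_sum => i _.
by rewrite opprD addrACA ler_normD.
Qed.

Lemma locally_acN f : locally_ac f -> locally_ac (\- f).
Proof.
move=> acf a b e e0; have [d d0 fd] := acf a b e e0; exists d => // n s t st std.
apply: le_lt_trans (fd _ _ _ st std); apply: ler_sum => i _.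
by rewrite -opprD normrN.
Qed.

(** An increment of the product splits into increments of the two factors, each weighted by a bound
    for the other factor on the compact interval. *)
Lemma locally_acM f g : locally_ac f -> locally_ac g -> locally_ac (f \* g).
Proof.
move=> acf acg a b e e0.
have [M M0 fM] := continuous_itv_bounded a b (locally_ac_continuous acf).
have [N N0 gN] := continuous_itv_bounded a b (locally_ac_continuous acg).
have eN : 0 < e / 2 / N by rewrite !divr_gt0.
have eM : 0 < e / 2 / M by rewrite !divr_gt0.
have [d1 d10 fd] := acf a b _ eN; have [d2 d20 gd] := acg a b _ eM.
exists (Num.min d1 d2); first by rewrite lt_min d10.
move=> n s t st; rewrite lt_min => /andP[/(fd _ _ _ st) fst /(gd _ _ _ st) gst].
rewrite [ltRHS]splitr.
apply: (@le_lt_trans _ _ (N * \sum_(i < n) `|f (t i) - f (s i)| +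
                          M * \sum_(i < n) `|g (t i) - g (s i)|)).
  rewrite !mulr_sumr -big_split/=; apply: ler_sum => i _.
  have [asi sti tib] := st.1 i (ltn_ord i).
  rewrite (_ : _ - _ = g (t i) * (f (t i) - f (s i)) +
    f (s i) * (g (t i) - g (s i))); last by rewrite /=; ring.
  rewrite (le_trans (ler_normD _ _))// !normrM lerD// ler_wpM2r//.
    by apply: gN => //; lra.
  by apply: fM => //; lra.
by apply: ltrD; rewrite -ltr_pdivlMl// mulrC.
Qed.

(** The step at the supremum of the points satisfying [P] carries [P] from a nearby point not beyond
    it to a point strictly beyond, unless [b] is reached. *)
Lemma real_induction (P : R -> Prop) a b : a <= b -> P a ->
  (forall x, a <= x -> x <= b -> exists2 d, 0 < d &
    forall y z, a <= y -> x - d < y -> y <= x -> x <= z -> z < x + d -> z <= b ->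
      P y -> P z) ->
  P b.
Proof.
move=> ab Pa step; pose S := [set x | a <= x <= b /\ P x].
have Sa : S a by rewrite /S /= lexx ab.
have ubS : ubound S b by move=> x [/andP[_]].
have hsS : has_sup S by split; [exists a|exists b].
have ac : a <= sup S by apply: ub_le_sup => //; exists b.
have cb : sup S <= b by apply: ge_sup => //; exists a.
have [d d0 Pd] := step _ ac cb.
have [y [/andP[ay yb] Py] dy] := sup_adherent d0 hsS.
have yc : y <= sup S by apply: ub_le_sup; [exists b|split=> //; rewrite ay].
pose z := Num.min b (sup S + d / 2).
have zb : z <= b by rewrite ge_min lexx.
have cz : sup S <= z by rewrite le_min cb lerDl divr_ge0// ltW.
have zd : z < sup S + d by rewrite gt_min ltrD2l ltr_pdivrMr// ltr_pMr// ltr1n orbT.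
have Pz : P z by exact: (Pd y z).
have zc : z <= sup S.
  by apply: ub_le_sup; [exists b|split=> //; rewrite (le_trans ac cz)].
suff -> : b = z by [].
move: zc; rewrite {1}/z ge_min => /orP[bc|]; last lra.
by apply/eqP; rewrite eq_le (le_trans bc cz).
Qed.

(** The straddle lemma: the estimates on the two sides of [x] add up to [e * (z - y)] because [x]
    lies between [y] and [z]. *)
Lemma is_derive0_straddle f x e : is_derive x 1 f 0 -> 0 < e ->
  exists2 d, 0 < d & forall y z, x - d < y -> y <= x -> x <= z -> z < x + d ->
    `|f z - f y| <= e * (z - y).
Proof.
move=> [df f'x] e0.
have : (h^-1 *: ((f \o shift x) (h *: 1) - f x)) @[h --> (0 : R)^'] --> (0 : R).
  by rewrite -[X in _ --> X]f'x; exact: df.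
move=> /cvgr0Pnorm_lt /(_ _ e0)[d /= d0 fd].
have {}fd y : `|y - x| < d -> `|f y - f x| <= e * `|y - x|.
  have [->|yx yxd] := eqVneq y x; first by rewrite !subrr normr0 mulr0.
  have h0 : y - x != 0 by rewrite subr_eq0.
  have := fd (y - x); rewrite /= sub0r normrN => /(_ yxd h0) /ltW.
  rewrite /shift/= scaler1 subrK.
  rewrite /GRing.scale/= normrM normfV mulrC ler_pdivrMr ?normr_gt0//.
exists d => // y z dy yx xz zd.
rewrite -(subrKA (f x)) (le_trans (ler_normD _ _))//.
have -> : z - y = `|z - x| + `|y - x| by rewrite ger0_norm ?ler0_norm; lra.
rewrite mulrDr lerD ?fd//; first by rewrite ger0_norm; lra.
by rewrite distrC fd// ler0_norm; lra.
Qed.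

(* A gauge argument: intervals tagged outside the exceptional null set [N]
   contribute at most [e * (b - a)], the other ones lie in an open set of small
   measure around [N], so that absolute continuity applies to them. *)
Lemma locally_ac_derive0 f : locally_ac f ->
  {ae mu, forall x, is_derive x 1 f 0} -> forall a b, a <= b -> f a = f b.
Proof.
move=> acf [N [mN N0 f0]] a b ab.
suff fab e : 0 < e -> `|f b - f a| <= e.
  apply/esym/eqP; rewrite -subr_eq0 -normr_le0; apply/ler_addgt0Pr => e e0.
  by rewrite add0r fab.
(* Chosen so that [eps * (b - a) + eps = e]: the first term pays for the good intervals, the second
   for the chain around [N]. *)
move=> e0; pose eps := e / (b - a + 1).
have ba0 : 0 < b - a + 1 by rewrite ltr_wpDl// subr_ge0.
have eps0 : 0 < eps by rewrite divr_gt0.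
have [d d0 fd] := acf a b eps eps0.
have [U [oU NU Ud]] : exists U, [/\ open U, N `<=` U & (mu (U `\` N) < d%:E)%E].
  by apply: lebesgue_regularity_outer => //; rewrite [ltLHS]N0.
have {}Ud : (mu U < d%:E)%E.
  have mU : measurable U by exact: open_measurable.
  have UN0 : mu (U `&` N) = 0.
    apply: (@subset_measure0 _ _ _ mu _ N) => //; exact: measurableI.
  by rewrite (measureDI mu mU mN) [X in (_ + X)%E]UN0 adde0.
(* The invariant carried from [a] to [b]: the chain inside [U] collects the bad intervals, the good
   ones cost only slope [eps]. *)
pose P x := exists n s t, [/\ interval_chain a x n s t,
  forall i, (i < n)%N -> `]s i, t i] `<=` U &
  `|f x - f a| <= eps * (x - a) + \sum_(i < n) `|f (t i) - f (s i)|].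
suff : P b.
  move=> [n [s [t [st stU /le_trans]]]]; apply.
  have std : \sum_(i < n) (t i - s i) < d.
    rewrite -lte_fin -(interval_chain_measure st).
    apply: le_lt_trans Ud; apply: le_measure; rewrite ?inE//.
    - by apply: bigsetU_measurable => i _; exact: measurable_itv.
    - exact: open_measurable.
    - apply: (big_ind (fun A => A `<=` U)) => [|A B AU BU|i _]; last exact: stU.
        exact: sub0set.
      by rewrite subUset.
  apply: (@le_trans _ _ (eps * (b - a + 1))).
    by rewrite [leRHS]mulrDr mulr1 lerD2l ltW// fd.
  by rewrite /eps divfK// gt_eqF.
apply: (real_induction ab) => [|x ax xb].
  exists 0%N, (fun=> 0), (fun=> 0); rewrite !subrr mulr0 big_ord0 normr0 addr0.
  split => //; split=> // i j; by rewrite ltn0 andbF.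
(* At a point of zero derivative the chain stays the same and the slope term absorbs the
   increment. *)
have [f'x|f'x] := pselect (is_derive x 1 f 0).
  have [r r0 fr] := is_derive0_straddle f'x eps0.
  exists r => // y z ay ry yx xz zr zb [n [s [t [st stU fya]]]].
  exists n, s, t; split => //.
    by split=> [i /st.1[asi sti ty]|]; [split=> //; lra|exact: st.2].
  have fzy := fr _ _ ry yx xz zr.
  rewrite -(subrKA (f y)) (le_trans (ler_normD _ _))// (le_trans (lerD fzy fya))//.
  by rewrite addrA -mulrDr addrA subrK.
(* Otherwise [x] is in [N], hence interior to [U], and the interval from [y] to [z] joins the
   chain. *)
have /nbhs_ballP[r /= r0 xrU] : nbhs x U.
  by apply: open_nbhs_nbhs; split => //; apply: NU; exact: f0.
exists r => // y z ay ry yx xz zr zb [n [s [t [st stU fya]]]].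
have yz : y <= z by lra.
have := interval_chain_rcons st ay yz.
set s' := (fun i => if _ then _ else y); set t' := (fun i => if _ then _ else z).
move=> st'; exists n.+1, s', t'; split => //.
  move=> i; rewrite /s' /t'; case: ifPn => [/stU//|_ _] w /=.
  rewrite in_itv/= => /andP[yw wz]; apply: xrU.
  by rewrite /ball/= ltr_distlC; apply/andP; split; lra.
rewrite big_ord_recr/= /s' /t' ltnn.
under eq_bigr => i _ do rewrite ltn_ord.
rewrite -(subrKA (f y)) (le_trans (ler_normD _ _))// [leLHS]addrC [leRHS]addrA lerD2r.
rewrite (le_trans fya)// lerD2r ler_wpM2l//; lra.
Qed.

End locally_ac.

(** * Integrals of derivatives *)

Section primitive.
Variable R : realType.
Local Notation mu := (@lebesgue_measure R).
Implicit Types (a b x : R) (h k : R -> R).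

Definition primitive k x := \int[mu]_(t in `]-oo, x]) k t.

Lemma primitiveB k a b : mu.-integrable setT (EFin \o k) -> a <= b ->
  primitive k b - primitive k a = \int[mu]_(t in `]a, b]) k t.
Proof.
move=> ik ab; apply: Rintegral_itvB => //.
by apply: integrableS ik.
Qed.

(** Absolute continuity of the integral of the modulus of [k], applied to the union of the chain. *)
Lemma locally_ac_primitive k : mu.-integrable setT (EFin \o k) ->
  locally_ac (primitive k).
Proof.
move=> ik a b e e0; have [d [d0 kd]] := integral_normr_continuous ik e0.
exists d => // n s t st std.
pose I (i : 'I_n) : set (measurableTypeR R) := `]s i, t i]%classic.
have mI i : measurable (I i) by exact: measurable_itv.
have mIU : measurable (\big[setU/set0]_(i < n) I i) by exact: bigsetU_measurable.
have ink D : measurable D -> mu.-integrable D (EFin \o (fun x => `|k x|)).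
  by move=> mD; apply: integrableS (integrable_norm ik).
apply: le_lt_trans (kd (\big[setU/set0]_(i < n) I i) mIU _); last first.
  by rewrite [ltLHS](interval_chain_measure st) lte_fin.
rewrite -lee_fin [leRHS]fineK; last exact: integrable_fin_num (ink _ mIU).
rewrite ge0_integral_bigsetU//; first last.
- exact: measurable_int (ink _ mIU).
- by apply: sub_trivIset (interval_chain_trivIset st).
- exact: index_enum_uniq.
rewrite -sumEFin; apply: lee_sum => i _.
have [_ sti _] := st.1 i (ltn_ord i).
rewrite primitiveB// -[leRHS]fineK; last exact: integrable_fin_num (ink _ (mI i)).
by rewrite lee_fin le_normr_Rintegral//; exact: integrableS ik.
Qed.

Lemma is_derive_primitive k : mu.-integrable setT (EFin \o k) ->
  {ae mu, forall x, is_derive x 1 (primitive k) (k x)}.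
Proof.
move=> ik; have := @FTC1Ny R k.
have iky y : mu.-integrable `]-oo, y] (EFin \o k) by exact: integrableS ik.
move=> /(_ iky (open_integrable_locally openT ik)).
apply: (@filterS _ _ (ae_filter_ringOfSetsType mu)) => x [dk k'x].
apply: DeriveDef; [exact: dk|rewrite -derive1E; exact: k'x].
Qed.

(** The difference of [h] and [primitive k] has zero derivative almost everywhere, so it is
    constant. *)
Lemma locally_ac_FTC h k a b : mu.-integrable setT (EFin \o k) -> locally_ac h ->
  {ae mu, forall x, is_derive x 1 h (k x)} -> a <= b ->
  h b - h a = \int[mu]_(t in `]a, b]) k t.
Proof.
move=> ik ach h'k ab; rewrite -primitiveB//.
have : {ae mu, forall x, is_derive x 1 (h \+ (\- primitive k)) 0}.
  have := is_derive_primitive ik; move: h'k.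
  apply: (@filterS2 _ _ (ae_filter_ringOfSetsType mu)) => x hx kx.
  by rewrite -(subrr (k x)); exact: is_deriveB.
move=> /(locally_ac_derive0
  (locally_acD ach (locally_acN (locally_ac_primitive ik)))) /(_ _ _ ab) /=.
lra.
Qed.

(** Otherwise the integral of the modulus of [h] over [D] would be at least [e * mu D], which is
    infinite. *)
Lemma integrable_small h (D : set (measurableTypeR R)) e :
  mu.-integrable setT (EFin \o h) -> measurable D -> mu D = +oo%E -> 0 < e ->
  exists2 x, D x & `|h x| < e.
Proof.
move=> ih mD Doo e0; apply: contrapT => nh.
have : (\int[mu]_(x in D) `|(h x)%:E| < +oo)%E.
  by have /integrableP[] := integrableS measurableT mD (@subsetT _ D) ih.
apply/negP; rewrite -leNgt.
apply: (@le_trans _ _ (\int[mu]_(x in D) e%:E)%E).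
  by rewrite integral_cst// [X in (_ * X)%E]Doo gt0_muley ?lte_fin.
apply: ge0_le_integral => //.
- by move=> x _; rewrite lee_fin ltW.
- apply: measurableT_comp => //.
  exact: measurable_funTS (measurable_int _ ih).
- move=> x Dx; rewrite /= lee_fin leNgt; apply/negP => hx.
  by apply: nh; exists x.
Qed.

(** By dominated convergence the integral is the limit of increments of [h] over intervals growing
    to the whole line, with endpoints chosen where [h] is small. *)
Lemma integral_derive_eq0 h k : mu.-integrable setT (EFin \o h) ->
  mu.-integrable setT (EFin \o k) -> locally_ac h ->
  {ae mu, forall x, is_derive x 1 h (k x)} ->
  (\int[mu]_x (k x)%:E = 0)%E.
Proof.
move=> ih ik ach h'k.
have [a ah] : {a : nat -> R & forall n, a n <= - n%:R /\ `|h (a n)| < n.+1%:R^-1}.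
  apply: (@choice _ _ (fun n x => x <= - n%:R /\ `|h x| < n.+1%:R^-1)) => n.
  have [|||x] := @integrable_small h `]-oo, - n%:R] n.+1%:R^-1 ih => //.
    by rewrite [LHS]lebesgue_measure_itv/= ltNyr.
  by rewrite /= in_itv/= => xn hx; exists x.
have [b bh] : {b : nat -> R & forall n, n%:R <= b n /\ `|h (b n)| < n.+1%:R^-1}.
  apply: (@choice _ _ (fun n x => n%:R <= x /\ `|h x| < n.+1%:R^-1)) => n.
  have [|||x] := @integrable_small h `[n%:R, +oo[ n.+1%:R^-1 ih => //.
    by rewrite [LHS]lebesgue_measure_itv/= ltry.
  by rewrite /= in_itv/= andbT => xn hx; exists x.
pose f_ n x := ((k \_ `]a n, b n]) x)%:E.
(* Each [x] lies in []a n, b n]] as soon as [n] exceeds its modulus. *)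
have f_k x : f_ n x @[n --> \oo] --> (k x)%:E.
  apply: cvg_near_cst; near=> n.
  have : `|x| < n%:R by near: n; exact: nbhs_infty_gtr.
  have [an _] := ah n; have [nb _] := bh n.
  rewrite ltr_norml => /andP[nx xn]; rewrite /f_ patchE ifT//.
  by rewrite inE /= in_itv/= (le_lt_trans an)// ltW// (lt_le_trans xn).
have mf_ n : measurable_fun setT (f_ n).
  apply/measurable_EFinP; apply/(measurable_restrictT _ _).1 => //.
  apply: measurable_funTS; apply/measurable_EFinP; exact: measurable_int ik.
have [] := @dominated_convergence _ _ _ mu setT measurableT f_ (EFin \o k) (abse \o (EFin \o k)).
- exact: mf_.
- exact: measurable_int ik.
- by apply/aeW => x _; exact: f_k.
- exact: integrable_abse.
- apply/aeW => x n _; rewrite /f_ /= lee_fin patchE; case: ifP => // _.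
  by rewrite normr0.
move=> _ _ fk.
apply: (cvg_unique _ fk) => //.
have -> : (fun n => \int[mu]_x f_ n x)%E = EFin \o (fun n => h (b n) - h (a n)).
  apply/funext => n /=; have [an _] := ah n; have [nb _] := bh n.
  have ab : a n <= b n.
    apply: le_trans an (le_trans _ nb); apply: (@le_trans _ _ 0).
      by rewrite oppr_le0.
    exact: ler0n.
  rewrite (locally_ac_FTC ik ach h'k ab).
  rewrite fineK; last by apply: integrable_fin_num => //; exact: integrableS ik.
  rewrite [RHS]integral_mkcond; apply: eq_integral => x _.
  by rewrite /f_ restrict_EFin.
apply/cvg_EFin; first exact: nearW.
apply/cvgr0Pnorm_lt => e e0; near=> n.
have [_ han] := ah n; have [_ hbn] := bh n.
have ne : n.+1%:R^-1 < e / 2.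
  by near: n; apply: near_infty_natSinv_lt (PosNum (divr_gt0 e0 (ltr0n _ 2))).
by rewrite (le_lt_trans (ler_normB _ _))// [ltRHS]splitr ltrD// (lt_trans _ ne).
Unshelve. all: by end_near. Qed.

End primitive.

(** * Norms in dense sets, and log-convex sequences *)

Section density.
Variables (K : numFieldType) (X : normedModType K) (S : set X).
Hypothesis dS : dense S.

Lemma dense_norm_lt c : 0 < c -> exists2 g, S g & `|g| < c.
Proof.
move=> c0; have [|g [+ Sg]] := dS _ (ball_open (0 : X) c).
  by exists 0; exact: ballxx.
by rewrite -ball_normE /= sub0r normrN; exists g.
Qed.

Lemma dense_norm_gt (v : X) c : v != 0 -> 0 < c -> exists2 g, S g & c < `|g|.
Proof.
(* A vector of norm [2c]: every point closer to it than [c] has norm above [c]. *)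
move=> v0 c0; pose w := (c *+ 2 / `|v|) *: v.
have wE : `|w| = c *+ 2.
  rewrite normrZ normrM normfV normr_id divfK ?normr_eq0//.
  by rewrite gtr0_norm// pmulrn_lgt0.
have [|g [+ Sg]] := dS _ (ball_open w c); first by exists w; exact: ballxx.
rewrite -ball_normE /= => wg; exists g => //.
rewrite -(ltrD2r c) -mulr2n -wE.
have := ler_normD (w - g) g; rewrite subrK => /le_lt_trans; apply.
by rewrite addrC ltrD2l.
Qed.

End density.

(** Either no step is a strict increase and the first term bounds the sequence, or all steps from
    some index on are, and the finitely many earlier terms are positive. *)
Lemma log_convex_bounded (R : realFieldType) (a : nat -> R) :
  (forall n, 0 <= a n) -> (forall n, a n.+1 ^+ 2 <= a n * a n.+2) ->
  exists2 c, 0 < c & (forall n, a n <= c) \/ (forall n, c <= a n).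
Proof.
move=> a0 a2; have [[n an]|ndec] := pselect (exists n, a n < a n.+1); last first.
  (* The [+ 1] keeps the bound positive when the first term is 0. *)
  exists (a 0%N + 1); first by rewrite ltr_wpDl.
  left=> n; apply: (@le_trans _ _ (a 0%N)); last by rewrite lerDl.
  elim: n => // n; apply: le_trans; rewrite leNgt; apply/negP => an.
  by apply: ndec; exists n.
(* Growth persists: a step down after a strict increase would make the middle term squared exceed
   the product of its neighbours. *)
have ninc m : a (n + m)%N < a (n + m).+1.
  elim: m => [|m IH]; first by rewrite addn0.
  rewrite addnS ltNge; apply/negP => am.
  have := a2 (n + m)%N; apply/negP; rewrite -ltNge.
  apply: (@le_lt_trans _ _ (a (n + m)%N * a (n + m).+1)); first by rewrite ler_wpM2l.
  by rewrite expr2 ltr_pM2r// (le_lt_trans (a0 _) IH).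
(* Positivity descends from [n.+1]: by log-convexity a zero term would force the next term to
   vanish. *)
have apos m : (m <= n.+1)%N -> 0 < a m.
  move=> mn; have := le_lt_trans (a0 n) an; rewrite -(subnKC mn).
  elim: (n.+1 - m)%N => [|j IH]; first by rewrite addn0.
  rewrite addnS => amj; apply: IH; rewrite lt_def a0 andbT; apply/eqP => aj.
  by have := a2 (m + j)%N; rewrite aj mul0r; apply/negP; rewrite -ltNge exprn_gt0.
have [c c0 ca] : exists2 c, 0 < c & forall m, (m <= n)%N -> c <= a m.
  have : forall m, (m <= n)%N -> 0 < a m by move=> m mn; rewrite apos// leqW.
  elim: n {an ninc apos} => [|n IH] apos.
    by exists (a 0%N) => [|m]; [exact: apos|rewrite leqn0 => /eqP ->].
  have [m mn|c c0 ca] := IH; first by rewrite apos// leqW.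
  exists (Num.min c (a n.+1)); first by rewrite lt_min c0 apos.
  move=> m; rewrite leq_eqVlt => /predU1P[->|/ca cam].
    by rewrite ge_min lexx orbT.
  by rewrite ge_min cam.
exists c => //; right=> m; have [/ca//|/ltnW nm] := leqP m n.
rewrite -(subnKC nm); elim: (m - n)%N => [|j IH]; first by rewrite addn0 ca.
by rewrite (le_trans IH)// addnS ltW.
Qed.

(** * Log-convexity of the norms along an orbit of d/dx *)

Section ddx_log_convex.
Variable R : realType.
Local Notation C := R[i].
Local Notation mu := (@lebesgue_measure R).
Implicit Types F G H : R -> C^o.

(** Here [p] stands for the real or imaginary part, both 1-Lipschitz for the modulus. *)
Lemma abs_continuous_locally_ac (p : C -> R) F :
  (forall z w : C, `|p z - p w| <= Normc.normc (z - w)) ->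
  abs_continuous F -> locally_ac (p \o F).
Proof.
move=> p1 acF a b e e0; have [d d0 Fd] := acF a b e e0; exists d => // n s t st std.
apply: le_lt_trans (Fd n (s \o val) (t \o val) _ _ std).
- by apply: ler_sum => i _; exact: p1.
- by move=> i; exact: (st.1 i (ltn_ord i)).
(* Disjointness is asked of open intervals, which lie inside the half-open ones of the chain. *)
- move=> i j _ _ ij; apply: (interval_chain_trivIset st) => //.
  apply: subset_nonempty ij; apply: setISS => x /=; rewrite !in_itv/=;
    by move=> /andP[-> /ltW].
Qed.

Lemma abs_continuous_Re F :
  abs_continuous F -> locally_ac (fun x => complex.Re (F x)).
Proof.
apply: abs_continuous_locally_ac => -[u v] [u' v'] /=.
by rewrite -sqrtr_sqr ler_wsqrtr// lerDl sqr_ge0.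
Qed.

Lemma abs_continuous_Im F :
  abs_continuous F -> locally_ac (fun x => complex.Im (F x)).
Proof.
apply: abs_continuous_locally_ac => -[u v] [u' v'] /=.
by rewrite -sqrtr_sqr ler_wsqrtr// lerDr sqr_ge0.
Qed.

(* [Re (conj (F x) * G x)] *)
Definition cdot F G x :=
  complex.Re (F x) * complex.Re (G x) + complex.Im (F x) * complex.Im (G x).

Lemma absCE F x : absC F x = Num.sqrt (cdot F F x).
Proof. by rewrite /absC /cdot; case: (F x). Qed.

Lemma cdot_sqr F x : cdot F F x = absC F x ^+ 2.
Proof. by rewrite absCE sqr_sqrtr// addr_ge0// -expr2 sqr_ge0. Qed.

Lemma cdot_CS F G x : `|cdot F G x| <= absC F x * absC G x.
Proof.
rewrite -sqrtr_sqr !absCE -sqrtrM; last by rewrite addr_ge0// -expr2 sqr_ge0.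
rewrite ler_wsqrtr// -subr_ge0 /cdot.
set a := complex.Re _; set b := complex.Im _; set c := complex.Re _; set d := complex.Im _.
(* Lagrange's identity in dimension two. *)
rewrite (_ : _ - _ = (a * d - b * c) ^+ 2) ?sqr_ge0//; ring.
Qed.

Lemma locally_ac_cdot F G : abs_continuous F -> abs_continuous G ->
  locally_ac (cdot F G).
Proof.
move=> acF acG; apply: locally_acD; apply: locally_acM;
  solve [exact: abs_continuous_Re|exact: abs_continuous_Im].
Qed.

Lemma is_derive_cdot F G x z w : is_cderive F x z -> is_cderive G x w ->
  is_derive x 1 (cdot F G) (cdot (cst z) G x + cdot F (cst w) x).
Proof.
move=> [F1 F2] [G1 G2].
apply: is_derive_eq (is_deriveD (is_deriveM F1 G1) (is_deriveM F2 G2)) _.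
rewrite /cdot /GRing.scale/=; ring.
Qed.

Lemma measurable_cdot F G : cmeasurable F -> cmeasurable G ->
  measurable_fun setT (cdot F G).
Proof.
by move=> [F1 F2] [G1 G2]; apply: measurable_funD; apply: measurable_funM.
Qed.

Lemma integrable_cdot F G : square_integrable F -> square_integrable G ->
  mu.-integrable setT (EFin \o cdot F G).
Proof.
move=> F2 G2; have /Lfun1_integrable := Lfun2_mul_Lfun1 (absC_Lfun F2) (absC_Lfun G2).
apply: le_integrable => //.
  by apply/measurable_EFinP; exact: measurable_cdot F2.1 G2.1.
move=> x _ /=; rewrite lee_fin (le_trans (cdot_CS F G x))//.
exact: ler_norm.
Qed.

Lemma L2norm_sqr F : square_integrable F ->
  fine (L2norm F) ^+ 2 = \int[mu]_x cdot F F x.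
Proof.
move=> F2; transitivity (fine (L2norm F `^ 2)%E).
  rewrite -[in RHS](fineK (x := L2norm F)).
    by rewrite /= powR_mulrn// fine_ge0// Lnorm_ge0.
  by rewrite ge0_fin_numE ?Lnorm_ge0//; exact: F2.2.
congr fine; rewrite /L2norm powR_Lnorm//; apply: eq_integral => x _.
by rewrite cdot_sqr /= ger0_norm ?absC_ge0// powR_mulrn// absC_ge0.
Qed.

Lemma integral_cdot_le F G : square_integrable F -> square_integrable G ->
  `|\int[mu]_x cdot F G x| <= fine (L2norm F) * fine (L2norm G).
Proof.
move=> F2 G2.
have ifg := integrable_cdot F2 G2.
apply: le_trans (le_normr_Rintegral measurableT ifg) _.
have fin H : square_integrable H -> L2norm H \is a fin_num.
  by move=> H2; rewrite ge0_fin_numE ?Lnorm_ge0//; exact: H2.2.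
rewrite -lee_fin EFinM !fineK ?fin//; last first.
  exact: (integrable_fin_num measurableT (integrable_norm ifg)).
apply: le_trans; last first.
  apply: (hoelder mu (measurable_absC F2.1) (measurable_absC G2.1)) => //.
  by rewrite [RHS]splitr !div1r.
rewrite Lnorm1; apply: ge0_le_integral => //.
- exact: measurable_int (integrable_norm ifg).
- apply/measurable_EFinP; apply: measurableT_comp => //.
  by apply: measurable_funM; exact: measurable_absC F2.1 || exact: measurable_absC G2.1.
- move=> x _; rewrite /= lee_fin (le_trans (cdot_CS F G x))//.
  exact: ler_norm.
Qed.

(** The function [cdot F G'] has almost everywhere derivative [cdot G' G' + cdot F H], of zero
    integral; Cauchy-Schwarz bounds the second term. *)
Lemma ddx_graph_log_convex (f g h : L2 R) : ddx_graph f g -> ddx_graph g h ->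
  `|g| ^+ 2 <= `|f| * `|h|.
Proof.
(* The class [g] has two representatives, equal almost everywhere: [G], the derivative of [F], and
   [G'], absolutely continuous with derivative [H]. *)
move=> [F [G [-> -> acF dF]]] [G' [H [/eqP/L2eqP GG' -> acG dG]]].
rewrite (_ : \pi_(L2 R) G = \pi_(L2 R) G'); last by apply/eqP/L2eqP.
rewrite -[`|\pi_(L2 R) G'|]/(L2nrm _) -[`|\pi_(L2 R) F|]/(L2nrm _).
rewrite -[`|\pi_(L2 R) H|]/(L2nrm _) !L2nrmE.
rewrite -rmorphXn -rmorphM lecR.
have sF := L2funP F; have sG := L2funP G'; have sH := L2funP H.
have iGG := integrable_cdot sG sG; have iFH := integrable_cdot sF sH.
have : (\int[mu]_x (cdot G' G' x + cdot F H x)%:E = 0)%E.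
  apply: (integral_derive_eq0 (integrable_cdot sF sG)).
  - exact: (integrableD measurableT iGG iFH).
  - exact: locally_ac_cdot.
  - apply: (@filterS3 _ _ (ae_filter_ringOfSetsType mu)) dF GG' dG => x /= dF GG' dG.
    rewrite GG' in dF; exact: is_derive_cdot dF dG.
move=> /(congr1 fine); rewrite [LHS]RintegralD//= => /eqP.
rewrite addr_eq0 => /eqP GF.
by rewrite L2norm_sqr// GF (le_trans (ler_norm _))// normrN integral_cdot_le.
Qed.

End ddx_log_convex.

(** * Neither kind of orbit is dense *)

Lemma ddx_orbit (R : realType) (f : L2 R) n : Cinfty (@ddx R) f ->
  ddx_graph (linop_exp (@ddx R) n f) (linop_exp (@ddx R) n.+1 f).
Proof. by move=> /(_ n.+1 Logic.I) [_ /ddx_funP]. Qed.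

Theorem corollary4p1 (R : realType) :
  ~ @hypercyclic R[i] (L2 R) (@ddx R) /\
  ~ @hypercyclic_family R[i] (L2 R) R (@translation R).
Proof.
split=> -[f [f0]].
  move=> Cf dense_orbit.
  (* The norm takes values in [R[i]]; [a n] is the real number behind it. *)
  pose a n := complex.Re `|linop_exp (@ddx R) n f|.
  have aE n : `|linop_exp (@ddx R) n f| = (a n)%:C%C by [].
  have a0 n : 0 <= a n by rewrite -lecR -aE; exact: normr_ge0.
  have a2 n : a n.+1 ^+ 2 <= a n * a n.+2.
    have := ddx_graph_log_convex (ddx_orbit n Cf) (ddx_orbit n.+1 Cf).
    by rewrite !aE -rmorphXn -rmorphM lecR.
  have [c c0 ca] := log_convex_bounded a0 a2.
  have {}c0 : 0 < c%:C%C :> R[i] by rewrite ltcR.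
  (* A dense orbit has points of norm above [c] and points of norm below [c], against either
     alternative. *)
  case: ca => ca.
    have [_ [n _ <-]] := dense_norm_gt dense_orbit f0 c0.
    by rewrite aE ltcR ltNge ca.
  have [_ [n _ <-]] := dense_norm_lt dense_orbit c0.
  by rewrite aE ltcR ltNge ca.
(* Density would give an orbit point of norm less than that of [f], but translations preserve the
   norm. *)
move=> _ /dense_norm_lt /(_ `|f|); rewrite normr_gt0 => /(_ f0)[_ [t _ <-]].
by rewrite translation_norm ltxx.
Qed.
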